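(* For each of the following four cases there are (on $\mathbf{C}^n$ for some $n$) Hermitian symmetric polynomials $q$ and $r$ such that the stated equalities hold: \begin{itemize} \item $\mathbf{s}(q)=(2,2)$, $\mathbf{s}(r)=(2,1)$, and $\mathbf{s}(qr)=(1,1)$. \item $\mathbf{s}(q)=(5,0)$, $\mathbf{s}(r)=(3,2)$, and $\mathbf{s}(qr)=(2,0)$. \item $\mathbf{s}(q)=(6,3)$, $\mathbf{s}(r)=(2,1)$, and $\mathbf{s}(qr)=(2,0)$. \item $\mathbf{s}(q)=(3,3)$, $\mathbf{s}(r)=(2,1)$, and $\mathbf{s}(qr)=(2,2)$. \end{itemize}
   Context: A Hermitian symmetric polynomial on $\mathbf{C}^n$ is a polynomial $p(z,\overline{w})=\sum_{\alpha,\beta}c_{\alpha\beta}z^\alpha\overline{w}^\beta$ whose coefficient matrix $(c_{\alpha\beta})$ is Hermitian; it is identified with the real-valued function $p(z,\overline z)$. The signature pair $\mathbf{s}(p)=(A,B)$ means that the coefficient matrix has $A$ positive and $B$ negative eigenvalues. Products are ordinary products of polynomials. *)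

(* Defs.v *)
From HB Require Import structures.
From mathcomp Require Import all_boot all_order all_algebra.
From mathcomp Require Import complex mpoly.
From mathcomp Require Import reals.

Set Implicit Arguments.
Unset Strict Implicit.
Unset Printing Implicit Defensive.

Import Order.TTheory GRing.Theory Num.Theory.
Local Open Scope ring_scope.
Local Open Scope complex_scope.

Section HermitianPolynomials.

Variables (R : realType) (n : nat).

Local Notation C := R[i].

(* A polynomial p(z, wbar) in z and wbar is an element of {mpoly C[n + n]}:
   the first n variables are the coordinates of z, the last n those of wbar.
   [mnm_cat a b] is the exponent of z^a wbar^b. *)
Definition mnm_cat (a b : 'X_{1..n}) : 'X_{1..n + n} :=
  [multinom match split i with inl j => a j | inr j => b j end | i < n + n].

(* The exponents of degree < msize p contain all a and b such that
   z^a wbar^b occurs in p, so the rows and columns left out are zero. *)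
Definition coef_mx (p : {mpoly C[n + n]}) :
    'M[C]_#|{: 'X_{1..n < msize p}}| :=
  \matrix_(i, j)
    let a : 'X_{1..n < msize p} := enum_val i in
    let b : 'X_{1..n < msize p} := enum_val j in
    p@_(mnm_cat a b).

Definition hermitian_symmetric (p : {mpoly C[n + n]}) : Prop :=
  coef_mx p \is hermsymmx.

End HermitianPolynomials.

(* The roots of the characteristic polynomial, repeated according to their
   multiplicities. *)
Definition eigenvalues (R : realType) (m : nat) (M : 'M[R[i]]_m) : seq R[i] :=
  sval (closed_field_poly_normal (char_poly M)).

(* In R[i], 0 < x means that x is real and positive. *)
Definition signature_pair (R : realType) (n : nat)
    (p : {mpoly R[i][n + n]}) : nat * nat :=
  (count (fun x => 0 < x) (eigenvalues (coef_mx p)),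
   count (fun x => x < 0) (eigenvalues (coef_mx p))).

(* Main.v *)
(* A real polynomial f = sum_k f_k x^k in one variable gives the Hermitian
   symmetric polynomial f(z zbar) = sum_k f_k |z|^(2k) on C^1, whose coefficient
   matrix is diagonal with entries f_k. Its signature pair counts the positive
   and the negative coefficients of f, and f |-> f(z zbar) is multiplicative, so
   each case is a factorization of a real polynomial in x. *)

Require Import Defs.
From HB Require Import structures.
From mathcomp Require Import all_boot all_order all_algebra.
From mathcomp Require Import complex mpoly.
From mathcomp Require Import reals.
From mathcomp Require Import ring.

Set Implicit Arguments.
Unset Strict Implicit.
Unset Printing Implicit Defensive.

Import Order.TTheory GRing.Theory Num.Theory.
Local Open Scope ring_scope.
Local Open Scope complex_scope.

(** The characteristic polynomial is the product of the ['X - (M i i)%:P], and a factorization into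
    monic linear factors is unique up to order. *)
Lemma eigenvalues_diag (R : realType) (m : nat) (M : 'M[R[i]]_m) :
  is_diag_mx M -> perm_eq (eigenvalues M) [seq M i i | i <- enum 'I_m].
Proof.
move=> Mdiag; rewrite /eigenvalues; case: closed_field_poly_normal => s /= Ms.
move: Ms; rewrite (monicP (char_poly_monic M)) scale1r => Ms.
apply: prod_XsubC_eq; rewrite -Ms char_poly_trig ?is_diag_mx_is_trig //.
by rewrite big_map big_enum.
Qed.

Section DiagonalPolynomials.

Variable R : realType.

(** This is [f] evaluated at the monomial z wbar. As a composite of two ring morphisms, it is
    visibly multiplicative. *)
Definition diag_mpoly (f : {poly R}) : {mpoly R[i][1 + 1]} :=
  (map_poly (@mpolyC (1 + 1) R[i] \o real_complex R) f).[
    'X_[U_(lshift 1 ord0) + U_(rshift 1 ord0)]].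

Lemma diag_mpolyM (f g : {poly R}) :
  diag_mpoly (f * g) = diag_mpoly f * diag_mpoly g.
Proof. by rewrite /diag_mpoly rmorphM hornerM. Qed.

Lemma diag_mnm_eq (a b : 'X_{1..1}) (k : nat) :
  (((U_(lshift 1 ord0) + U_(rshift 1 ord0)) *+ k)%MM == mnm_cat a b)
  = (a == b) && (k == a ord0).
Proof.
have -> : (a == b) = (a ord0 == b ord0).
  apply/eqP/eqP => [->//|ab]; apply/mnmP => i.
  by rewrite (ord1 i).
apply/eqP/andP => [/mnmP e | [/eqP ab /eqP ka]].
  have := e (lshift 1 ord0); have := e (rshift 1 ord0).
  rewrite !mulmnE !mnmDE !mnmE (unsplitK (inl _ : 'I_1 + 'I_1)).
  by rewrite (unsplitK (inr _ : 'I_1 + 'I_1)) eqxx /= !mul1n => <- <-.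
apply/mnmP => i; rewrite -(splitK i) mulmnE mnmDE !mnmE unsplitK.
by case: (split i) => j; rewrite (ord1 j) -?ab -ka mul1n.
Qed.

Lemma mcoeff_diag_mpoly (f : {poly R}) (a b : 'X_{1..1}) :
  (diag_mpoly f)@_(mnm_cat a b) = (f`_(a ord0))%:C *+ (a == b).
Proof.
rewrite /diag_mpoly /map_poly horner_poly raddf_sum /=.
under eq_bigr => i _ do rewrite mcoeffCM mcoeffXn diag_mnm_eq.
case: (a == b) => /=; last by rewrite big1 // => i _; rewrite mulr0.
have [lt_a|ge_a] := ltnP (a ord0) (size f).
  rewrite (bigD1 (Ordinal lt_a)) //= eqxx mulr1 big1 ?addr0 // => i.
  by rewrite -val_eqE /= => /negPf ->; rewrite mulr0.
rewrite nth_default // big1 // => i _.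
by rewrite ltn_eqF ?mulr0 // (leq_trans _ ge_a).
Qed.

Lemma coef_mx_diag_mpoly (f : {poly R}) :
  coef_mx (diag_mpoly f) =
  diag_mx (\row_i (f`_((enum_val i : 'X_{1..1 < msize (diag_mpoly f)}) ord0))%:C).
Proof.
apply/matrixP => i j; rewrite !mxE /=.
rewrite mcoeff_diag_mpoly val_eqE.
by rewrite (inj_eq enum_val_inj).
Qed.

Lemma diag_mpoly_hermitian (f : {poly R}) : hermitian_symmetric (diag_mpoly f).
Proof.
rewrite /hermitian_symmetric coef_mx_diag_mpoly; apply/is_hermitianmxP.
rewrite expr0 scale1r tr_diag_mx map_diag_mx; congr diag_mx.
by apply/rowP => i; rewrite !mxE; apply/esym/conjc_real.
Qed.

(** The coefficient of x^k reappears at z^k wbar^k, of degree 2k >= k. Hence the index set of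
    [coef_mx] reaches every nonzero coefficient of [f]. *)
Lemma size_diag_mpoly (f : {poly R}) : (size f <= msize (diag_mpoly f))%N.
Proof.
apply/leq_sizeP => k le_k; pose a : 'X_{1..1} := (U_(ord0) *+ k)%MM.
have ak : a ord0 = k by rewrite /a mulmnE mnmE eqxx mul1n.
suff: (diag_mpoly f)@_(mnm_cat a a) = 0.
  by rewrite mcoeff_diag_mpoly eqxx ak => -[].
apply/memN_msupp_eq0/msize_mdeg_ge/(leq_trans le_k).
rewrite mdegE (bigD1 (lshift 1 ord0)) //= mnmE.
by rewrite (unsplitK (inl _ : 'I_1 + 'I_1)) ak leq_addr.
Qed.

(** A multi-index in one variable is its own degree; only the order of enumeration is left open. *)
Lemma perm_mnm1 (m : nat) :
  perm_eq [seq (enum_val i : 'X_{1..1 < m}) ord0 | i <- enum 'I_#|{: 'X_{1..1 < m}}|]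
          (iota 0 m).
Proof.
have deg1 (a : 'X_{1..1}) : mdeg a = a ord0 by rewrite mdegE big_ord1.
apply: uniq_perm; rewrite ?iota_uniq //.
  rewrite map_inj_uniq ?enum_uniq // => i j ij; apply/enum_val_inj/val_inj/mnmP => k.
  by rewrite (ord1 k).
move=> k; rewrite mem_iota add0n; apply/mapP/idP => [[i _ ->]|lt_k].
  by rewrite -deg1 bmdeg.
pose a : 'X_{1..1} := (U_(ord0) *+ k)%MM.
have ak : a ord0 = k by rewrite /a mulmnE mnmE eqxx mul1n.
have lt_a : (mdeg a < m)%N by rewrite deg1 ak.
by exists (enum_rank (BMultinom lt_a)); rewrite ?mem_enum // enum_rankK.
Qed.

(** Zeros are not counted, so neither padding up to [m] nor trailing zeros of [s], which [Poly]
    drops, change the count. *)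
Lemma count_coef (P : pred R) (s : seq R) (m : nat) : ~~ P 0 ->
  (size (Poly s) <= m)%N -> count (fun k => P (Poly s)`_k) (iota 0 m) = count P s.
Proof.
move=> P0; elim: s m => [|x s IHs] m /= le_m.
  by rewrite (eq_count (a2 := pred0)) ?count_pred0 // => k; rewrite coef0 (negPf P0).
case: m le_m => [|m] le_m.
  (* With [m = 0] the polynomial vanishes, but the list may still consist of zeros. *)
  have /polyP s0 : cons_poly x (Poly s) = 0.
    by apply/eqP; rewrite -size_poly_eq0 -leqn0.
  have x0 : x = 0 by have := s0 0; rewrite coef_cons coef0.
  have sz : Poly s = 0.
    by apply/polyP => k; have := s0 k.+1; rewrite coef_cons !coef0.
  by rewrite x0 (negPf P0) add0n -(IHs 0%N) // sz size_poly0.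
rewrite /= coef_cons /= -(IHs m).
  rewrite (iotaDl 1 0) count_map; congr addn.
  by apply: eq_count => k /=; rewrite coef_cons.
apply/leq_sizeP => k le_k; have/leq_sizeP/(_ k.+1 le_k) := le_m.
by rewrite coef_cons.
Qed.

Lemma count_diag_mpoly (P : pred R[i]) (s : seq R) : ~~ P 0 ->
  count P (eigenvalues (coef_mx (diag_mpoly (Poly s)))) =
  count (fun x : R => P x%:C) s.
Proof.
move=> P0; set f := Poly s.
have /eigenvalues_diag/permP-> : is_diag_mx (coef_mx (diag_mpoly f)).
  by rewrite coef_mx_diag_mpoly diag_mx_is_diag.
rewrite -(@count_coef _ s (msize (diag_mpoly f))) ?size_diag_mpoly //.
rewrite -(permP (perm_mnm1 _)) !count_map; apply: eq_count => i /=.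
by rewrite coef_mx_diag_mpoly !mxE eqxx.
Qed.

Lemma signature_pair_diag_mpoly (s : seq R) :
  signature_pair (diag_mpoly (Poly s)) =
  (count (fun x => 0 < x) s, count (fun x => x < 0) s).
Proof.
by rewrite /signature_pair !count_diag_mpoly ?ltxx //; congr pair;
  apply: eq_count => x; rewrite ltcR.
Qed.

(** Coefficient lists reduce each case, with [n = 1], to one identity in [{poly R}] and three sign
    counts that compute. *)
Lemma factorization_signature_pairs (s t u : seq R) (A B A1 B1 A2 B2 : nat) :
  Poly s * Poly t = Poly u ->
  (count (fun x => 0 < x) s, count (fun x => x < 0) s) = (A, B) ->
  (count (fun x => 0 < x) t, count (fun x => x < 0) t) = (A1, B1) ->
  (count (fun x => 0 < x) u, count (fun x => x < 0) u) = (A2, B2) ->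
  exists (n : nat) (q r : {mpoly R[i][n + n]}),
    [/\ hermitian_symmetric q, hermitian_symmetric r,
        signature_pair q = (A, B), signature_pair r = (A1, B1)
      & signature_pair (q * r) = (A2, B2)].
Proof.
move=> stu sE tE uE; exists 1, (diag_mpoly (Poly s)), (diag_mpoly (Poly t)).
rewrite -diag_mpolyM stu !signature_pair_diag_mpoly.
by split=> //; apply: diag_mpoly_hermitian.
Qed.

End DiagonalPolynomials.

Theorem proposition4p2 (R : realType) :
  [/\ exists (n : nat) (q r : {mpoly R[i][n + n]}),
        [/\ hermitian_symmetric q, hermitian_symmetric r,
            signature_pair q = (2, 2)%N, signature_pair r = (2, 1)%N
          & signature_pair (q * r) = (1, 1)%N],
      exists (n : nat) (q r : {mpoly R[i][n + n]}),
        [/\ hermitian_symmetric q, hermitian_symmetric r,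
            signature_pair q = (5, 0)%N, signature_pair r = (3, 2)%N
          & signature_pair (q * r) = (2, 0)%N],
      exists (n : nat) (q r : {mpoly R[i][n + n]}),
        [/\ hermitian_symmetric q, hermitian_symmetric r,
            signature_pair q = (6, 3)%N, signature_pair r = (2, 1)%N
          & signature_pair (q * r) = (2, 0)%N]
    & exists (n : nat) (q r : {mpoly R[i][n + n]}),
        [/\ hermitian_symmetric q, hermitian_symmetric r,
            signature_pair q = (3, 3)%N, signature_pair r = (2, 1)%N
          & signature_pair (q * r) = (2, 2)%N]].
Proof.
(* [signE] decides the signs of numerals; [polyE] expands coefficient lists into expressions in ['X]
   for [ring]. *)
have signE := (@ltr01 R, @ltr10 R, @ltr0n R, @ltrn0 R, @ltxx _ R, @oppr_gt0 R, @oppr_lt0 R).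
have polyE := (@cons_poly_def R, @polyCN R, @polyC0 R, @polyC1 R, @polyC_natr R).
split.
(* (x^2 - 1) (x^2 + x + 1) (x^2 - x + 1) = x^6 - 1 *)
- apply: (@factorization_signature_pairs _ [:: -1; -1; 0; 1; 1] [:: 1; -1; 1]
            [:: -1; 0; 0; 0; 0; 0; 1]); [|by rewrite /= !signE ..].
  by rewrite /= !polyE; ring.
(* Cancelling the middle terms asks for a^2 = 2 b and b^2 + 2 = 2 a^2, hence b^2 - 4 b + 2 = 0; [b]
   is its larger root. *)
- pose b : R := 2 + Num.sqrt 2; pose a := Num.sqrt (2 * b).
  have b_gt0 : 0 < b by rewrite ltr_wpDr ?sqrtr_ge0.
  have a_gt0 : 0 < a by rewrite sqrtr_gt0 mulr_gt0.
  have aE : a ^+ 2 = 2 * b by rewrite sqr_sqrtr // ltW // mulr_gt0.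
  have bE : b ^+ 2 = 4 * b - 2.
    have := @sqr_sqrtr R 2 (ler0n _ 2); rewrite /b; move: (Num.sqrt 2) => y yE.
    by ring: yE.
(* With q = x^4 + a x^3 + b x^2 + a x + 1, the product q(x) q(-x) is
   x^8 + (2 b - a^2) (x^6 + x^2) + (b^2 + 2 - 2 a^2) x^4 + 1, and a and b are
   chosen to reduce it to x^8 + 1. *)
  apply: (@factorization_signature_pairs _ [:: 1; a; b; a; 1] [:: 1; - a; b; - a; 1]
            [:: 1; 0; 0; 0; 0; 0; 0; 0; 1]);
    [|by rewrite /= !(signE, a_gt0, b_gt0, lt_gtF a_gt0, lt_gtF b_gt0) ..].
  (* The relations are moved to constant polynomials, since [ring] works in [{poly R}]. *)
  move/(congr1 polyC): aE; move/(congr1 polyC): bE.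
  rewrite !expr2 !polyCB !polyCM !polyC_natr => bE aE.
  by rewrite /= !polyE; ring: bE aE.
(* (x^2 + 2 x + 2) (x^8 - 4 x^4 + 16) (x^2 - 2 x + 2) = x^12 + 64 *)
- apply: (@factorization_signature_pairs _ [:: 32; 32; 16; 0; -8; -8; -4; 0; 2; 2; 1]
            [:: 2; -2; 1] [:: 64; 0; 0; 0; 0; 0; 0; 0; 0; 0; 0; 0; 1]);
    [|by rewrite /= !signE ..].
  by rewrite /= !polyE; ring.
(* (x^3 - 1) (x^2 + 2 x + 2) (x^2 - 2 x + 2) = (x^3 - 1) (x^4 + 4) *)
- apply: (@factorization_signature_pairs _ [:: -2; -2; -1; 2; 2; 1] [:: 2; -2; 1]
            [:: -4; 0; 0; 4; -1; 0; 0; 1]); [|by rewrite /= !signE ..].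
  by rewrite /= !polyE; ring.
Qed.
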